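(* Let $p,q,r\ge 1$ and let $K_{p,q,r}\setminus\{e\}$ be the graph obtained from the complete tripartite graph $K_{p,q,r}$ by deleting an edge $e$. Then $\mathcal{E}_{RD}(K_{p,q,r}\setminus\{e\})\le \mathcal{E}_{RD}(K_{p,q,r})$.
   Context: For a connected graph $G$ with vertices $v_1,\dots,v_n$, $RD(G)$ is the $n\times n$ matrix with $(i,j)$ entry $1/d(v_i,v_j)$ for $i\ne j$ and $0$ on the diagonal ($d$ the shortest-path distance), and the reciprocal distance energy is $\mathcal{E}_{RD}(G)=\sum_{i=1}^n|\lambda_i(RD(G))|$. $K_{p,q,r}$ is the complete tripartite graph with parts of sizes $p,q,r$. *)

(* Defs.v *)
From HB Require Import structures.
From mathcomp Require Import all_boot all_order all_algebra.
From mathcomp Require Import polyrcf complex reals.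

Set Implicit Arguments.
Unset Strict Implicit.
Unset Printing Implicit Defensive.

Import Order.TTheory GRing.Theory Num.Theory.
Local Open Scope ring_scope.

(* A simple graph on a finite type V is given by its (symmetric, irreflexive) *)
(* adjacency relation e : rel V.                                              *)

Section Distance.
Variables (V : finType) (e : rel V).
Local Open Scope nat_scope.

Definition has_walk (x y : V) (k : nat) : bool :=
  [exists s : k.-tuple V, path e x s && (last x s == y)].

(* The least k < #|V| such that there is a walk of length k from x to y. Two  *)
(* connected vertices are joined by a walk of length < #|V|; if there is no   *)
(* walk, the value is #|V| (never relevant for a connected graph).            *)
Definition dist (x y : V) : nat := find (has_walk x y) (iota 0 #|V|).

Lemma dist_walk x y :
  connect e x y ->
  exists s : seq V, [/\ path e x s, last x s = y & size s = dist x y].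
Proof.
move=> /connectP[s0 ps0 ->]; case/shortenP: ps0 => s ps us _.
set y0 := last x s.
have sz : size s < #|V| by have := max_card [in x :: s]; rewrite (card_uniqP us).
have hw : has (has_walk x y0) (iota 0 #|V|).
  apply/hasP; exists (size s); first by rewrite mem_iota.
  by apply/existsP; exists (in_tuple s); rewrite ps eqxx.
have /existsP[t /andP[pt /eqP lt]] := nth_find 0 hw.
exists t; split=> //; rewrite size_tuple nth_iota //.
by rewrite -[X in _ < X](size_iota 0) -has_find.
Qed.

Lemma dist_min x (s : seq V) : path e x s -> dist x (last x s) <= size s.
Proof.
move=> ps; rewrite leqNgt; apply/negP => lts.
have ltV : size s < #|V|.
  by apply: leq_trans lts _; rewrite -[X in _ <= X](size_iota 0) find_size.
have := before_find 0 lts; rewrite nth_iota // add0n.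
suff -> : has_walk x (last x s) (size s) by [].
by apply/existsP; exists (in_tuple s); rewrite ps eqxx.
Qed.

End Distance.

Section Eigenvalues.
Variables (R : realType) (n : nat).

(* The real roots of the characteristic polynomial, each repeated according   *)
(* to its multiplicity; for symmetric A this is the full list of the n        *)
(* eigenvalues (lemma eigenvalues_sym).                                       *)
Definition eigenvalues (A : 'M[R]_n) : seq R :=
  flatten [seq nseq (mup x (char_poly A)) x | x <- rootsR (char_poly A)].

Lemma eigenvalues_perm (A : 'M[R]_n) (s : seq R) :
  char_poly A = \prod_(x <- s) ('X - x%:P) -> perm_eq (eigenvalues A) s.
Proof.
move=> As; have nz : char_poly A != 0 by rewrite monic_neq0 ?char_poly_monic.
apply/allP => x _ /=; apply/eqP; rewrite -[RHS]mu_prod_XsubC -As /eigenvalues.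
rewrite count_flatten -map_comp sumnE big_map.
under eq_bigr => y _ do rewrite /= count_nseq /= eq_sym.
have mem_r : (x \in rootsR (char_poly A)) = root (char_poly A) x.
  by have := roots_on_rootsR nz x; rewrite in_itv.
case: (boolP (x \in rootsR (char_poly A))) => [xr|nxr].
  rewrite (bigD1_seq x) //=; last exact: uniq_roots.
  rewrite eqxx mul1n big1 ?addn0 // => y ynx.
  by rewrite eq_sym (negPf ynx).
rewrite mupNroot -?mem_r // big_seq big1 // => y yr.
by case: eqP => // xy; rewrite xy yr in nxr.
Qed.

Lemma eigenvalues_sym (A : 'M[R]_n) :
  A^T = A -> char_poly A = \prod_(x <- eigenvalues A) ('X - x%:P).
Proof.
move=> symA.
suff [s As] : exists s : seq R, char_poly A = \prod_(x <- s) ('X - x%:P).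
  by rewrite {1}As; apply/esym/perm_big/eigenvalues_perm.
pose B : 'M[R[i]]_n := map_mx (real_complex R) A.
have hB : B \is hermsymmx.
  apply/is_hermitianmxP; rewrite expr0 scale1r; apply/matrixP => i j.
  rewrite !mxE -{1}symA mxE; apply/esym/CrealP.
  by apply/Creal_ImP; rewrite -complexIm.
have /orthomx_spectralP := hermitian_normalmx hB.
have /mxOverP dreal := hermitian_spectral_diag_real hB.
have Pu := spectral_unit B.
move: (spectralmx B) (spectral_diag B) Pu dreal => P d Pu dreal BE.
exists [seq complex.Re (d 0 i) | i <- enum 'I_n].
apply: (map_poly_inj (real_complex R)); rewrite map_char_poly -/B big_map.
rewrite rmorph_prod big_enum /=.
have -> : char_poly B = char_poly (diag_mx d).
  have PP : map_mx polyC (invmx P) *m map_mx polyC P = 1%:M.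
    by rewrite -map_mxM mulVmx // map_mx1.
  have -> : char_poly B = \det (map_mx polyC (invmx P) *m
      char_poly_mx (diag_mx d) *m map_mx polyC P).
    rewrite /char_poly /char_poly_mx mulmxBr mulmxBl -!map_mxM -BE.
    by rewrite scalar_mxC -mulmxA PP mulmx1.
  rewrite !det_mulmx mulrAC -det_mulmx PP det1 mul1r //.
rewrite char_poly_trig ?diag_mx_is_trig //; apply: eq_bigr => i _.
rewrite map_polyXsubC mxE eqxx mulr1n /real_complex_def.
congr ('X - _%:P); have /Creal_ImP := dreal 0 i.
by rewrite -complexIm; case: (d 0 i) => x y /= [->].
Qed.

End Eigenvalues.

Section ReciprocalDistance.
Variables (R : realType) (V : finType) (e : rel V).

Definition RD : 'M[R]_#|V| :=
  \matrix_(i, j) if i == j then 0 else (dist e (enum_val i) (enum_val j))%:R^-1.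

Definition RD_energy : R := \sum_(x <- eigenvalues RD) `|x|.

End ReciprocalDistance.

Section Tripartite.
Variables p q r : nat.

Definition tripartite_vertex : finType := ('I_p + 'I_q + 'I_r)%type.

Definition tripartite_part (x : tripartite_vertex) : 'I_3 :=
  match x with
  | inl (inl _) => inord 0
  | inl (inr _) => inord 1
  | inr _ => inord 2
  end.

Definition complete_tripartite : rel tripartite_vertex :=
  fun x y => tripartite_part x != tripartite_part y.

End Tripartite.

Definition delete_edge (V : finType) (e : rel V) (u v : V) : rel V :=
  fun x y => e x y && ([set x; y] != [set u; v]).

Lemma complete_tripartite_sym p q r : symmetric (@complete_tripartite p q r).
Proof. by move=> x y; rewrite /complete_tripartite eq_sym. Qed.

Lemma complete_tripartite_irr p q r : irreflexive (@complete_tripartite p q r).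
Proof. by move=> x; rewrite /complete_tripartite eqxx. Qed.

Lemma delete_edge_sym (V : finType) (e : rel V) (u v : V) :
  symmetric e -> symmetric (delete_edge e u v).
Proof. by move=> es x y; rewrite /delete_edge es setUC. Qed.

Lemma RD_sym (R : realType) (V : finType) (e : rel V) :
  symmetric e -> (RD R e)^T = RD R e.
Proof.
move=> es; apply/matrixP => i j; rewrite !mxE eq_sym.
have walk_sym x y k : has_walk e x y k -> has_walk e y x k.
  case/existsP => s /andP[ps /eqP <-]; apply/existsP.
  have sz : size (rev (belast x s)) == k by rewrite size_rev size_belast size_tuple.
  exists (Tuple sz) => /=; rewrite rev_path.
  rewrite (eq_path (e' := e)) ?ps /=; last by move=> a b; rewrite es.
  by case/lastP: (val s) => [|s' z] //=; rewrite belast_rcons rev_cons last_rcons.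
case: eqP => // _; congr (_%:R^-1); apply: eq_find => k.
by apply/idP/idP; apply: walk_sym.
Qed.

Lemma delete_edge_connected p q r (u v : tripartite_vertex p q r) :
  (0 < p)%N -> (0 < q)%N -> (0 < r)%N -> complete_tripartite u v ->
  forall x y, connect (delete_edge (@complete_tripartite p q r) u v) x y.
Proof.
move=> p0 q0 r0 uv.
have part_surj (c : 'I_3) :
    exists w : tripartite_vertex p q r, tripartite_part w = c.
  case: c => [[|[|[|//]]] lt3].
  - exists (inl (inl (Ordinal p0))); apply: val_inj; exact: inordK.
  - exists (inl (inr (Ordinal q0))); apply: val_inj; exact: inordK.
  - exists (inr (Ordinal r0)); apply: val_inj; exact: inordK.
have [c cu cv] : exists2 c : 'I_3, c != tripartite_part u & c != tripartite_part v.
  have : (0 < #|~: [set tripartite_part u; tripartite_part v]|)%N.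
    by rewrite cardsCs setCK card_ord cards2; case: eqP.
  by case/card_gt0P => c; rewrite !inE negb_or => /andP[]; exists c.
have [w wc] := part_surj c; rewrite -wc in cu cv.
have neq (x y : tripartite_vertex p q r) :
  tripartite_part x != tripartite_part y -> x != y by apply: contraNneq => ->.
have adj x y : complete_tripartite x y -> x != u -> x != v ->
    delete_edge (@complete_tripartite p q r) u v x y.
  move=> xy xu xv; rewrite /delete_edge xy; apply/eqP => /setP/(_ x).
  by rewrite !inE eqxx (negPf xu) (negPf xv).
set e := delete_edge _ u v in adj *.
have es : connect_sym e.
  apply: sym_connect_sym; apply: delete_edge_sym.
  exact: complete_tripartite_sym.
have wx x : connect e w x.
  have [xw|xw] := eqVneq (tripartite_part x) (tripartite_part w).
    apply: (@connect_trans _ _ u).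
      by apply/connect1/adj; rewrite ?neq.
    by rewrite es; apply/connect1/adj; rewrite ?neq // /complete_tripartite xw.
  by apply/connect1/adj; rewrite ?neq // /complete_tripartite eq_sym.
by move=> x y; apply: connect_trans (wx y); rewrite es.
Qed.

(* Main.v *)
Require Import Defs.
From mathcomp Require Import all_boot all_order all_algebra reals.
From mathcomp Require Import complex ring.

(* With u and v the ends of e, the matrix RD(K \ e) is J - (S + T) / 2, where J
   is the all-ones matrix, S the kernel "same part" and T the kernel "same
   vertex after merging v into u". As S and T are positive semidefinite and J
   has rank one, RD(K \ e) has at most one positive eigenvalue c. Both traces
   vanish, so each energy is twice the sum of the positive eigenvalues. If x is
   a unit eigenvector for c, then 0 <= RD(K \ e) <= RD(K) entrywise gives
   c = x RD(K \ e) x^* <= |x| RD(K) |x|^T, which is at most the sum of the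
   positive eigenvalues of RD(K). *)

Set Implicit Arguments.
Unset Strict Implicit.
Unset Printing Implicit Defensive.

Import Order.TTheory GRing.Theory Num.Theory.
Local Open Scope ring_scope.

(** * Hermitian forms and spectral decomposition of real symmetric matrices *)

Section Spectral.
Variables (R : realType) (n : nat).
Implicit Types (A B : 'M[R]_n) (x : 'I_n -> R[i]) (P : 'M[R[i]]_n).

Local Notation rc := (real_complex R).

Lemma real_complex_conj (a : R) : (rc a)^* = rc a.
Proof. exact: conjc_real. Qed.

Lemma real_complex_ge0 (a : R) : (0 <= rc a) = (0 <= a).
Proof. exact: (lecR 0 a). Qed.

(** The vectors are complex although the matrix is real, because the unitary diagonalization used
    below yields eigenvectors over [R[i]]. *)
Definition hform A x : R[i] := \sum_k \sum_l rc (A k l) * x k * (x l)^*.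

Lemma char_poly_similar (K : fieldType) (P B : 'M[K]_n) :
  P \in unitmx -> char_poly (invmx P *m B *m P) = char_poly B.
Proof.
move=> Pu; have PP : map_mx polyC (invmx P) *m map_mx polyC P = 1%:M.
  by rewrite -map_mxM mulVmx // map_mx1.
have -> : char_poly (invmx P *m B *m P) =
    \det (map_mx polyC (invmx P) *m char_poly_mx B *m map_mx polyC P).
  rewrite /char_poly /char_poly_mx mulmxBr mulmxBl -!map_mxM.
  by rewrite scalar_mxC -[_ *m _ *m map_mx _ P]mulmxA PP mulmx1.
by rewrite !det_mulmx mulrAC -det_mulmx PP det1 mul1r.
Qed.

(* The rows of P are orthonormal eigenvectors, for the eigenvalues d. *)
Definition spectral_decomposition A P (d : 'I_n -> R) :=
  [/\ forall i j, \sum_k P i k * (P j k)^* = (i == j)%:R,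
      forall k l, \sum_i (P i k)^* * P i l = (k == l)%:R,
      forall k l, rc (A k l) = \sum_i rc (d i) * ((P i k)^* * P i l)
    & perm_eq (eigenvalues A) [seq d i | i <- enum 'I_n]].

(** Over [R[i]] the matrix becomes Hermitian, hence unitarily diagonalizable with real eigenvalues.
    Similarity preserves the characteristic polynomial, whose factorization then descends to [R]. *)
Lemma sym_spectral A :
  A^T = A -> exists P d, spectral_decomposition A P d.
Proof.
move=> symA; pose B : 'M[R[i]]_n := map_mx rc A.
have hB : B \is hermsymmx.
  apply/is_hermitianmxP; rewrite expr0 scale1r; apply/matrixP => i j.
  by rewrite !mxE real_complex_conj -{1}symA mxE.
have /orthomx_spectralP := hermitian_normalmx hB.
have /mxOverP dreal := hermitian_spectral_diag_real hB.
have Pun := spectral_unitarymx B; have Pu := spectral_unit B.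
move: (spectralmx B) (spectral_diag B) Pun Pu dreal => P d Pun Pu dreal BE.
have dE i : d 0 i = rc (complex.Re (d 0 i)).
  have /Creal_ImP := dreal 0 i.
  by rewrite -complexIm; case: (d 0 i) => a b /= [->].
exists P, (fun i => complex.Re (d 0 i)); split.
- move=> i j; have /unitarymxP/matrixP/(_ i j) := Pun.
  by rewrite !mxE => <-; apply: eq_bigr => k _; rewrite !mxE.
- move=> k l; have /matrixP/(_ k l) := mulVmx Pu.
  rewrite invmx_unitary // !mxE => <-.
  by apply: eq_bigr => i _; rewrite !mxE.
- move=> k l; have /matrixP/(_ k l) := BE; rewrite invmx_unitary // !mxE => ->.
  apply: eq_bigr => i _; rewrite -dE mul_mx_diag !mxE.
  by rewrite [RHS]mulrA [d 0 i * _]mulrC.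
- apply: eigenvalues_perm; apply: (map_poly_inj rc).
  rewrite map_char_poly -/B big_map rmorph_prod big_enum /= {1}BE.
  rewrite char_poly_similar // char_poly_trig ?diag_mx_is_trig //.
  apply: eq_bigr => i _.
  by rewrite map_polyXsubC mxE eqxx mulr1n /= -dE.
Qed.

Lemma hform_spectral A P d x : spectral_decomposition A P d ->
  hform A x = \sum_i rc (d i) * `|\sum_k x k * (P i k)^*| ^+ 2.
Proof.
case=> _ _ AE _; rewrite /hform.
under eq_bigr => k _ do under eq_bigr => l _ do
  rewrite AE -mulrA mulr_suml.
under eq_bigr => k _ do rewrite exchange_big /=.
rewrite exchange_big /=; apply: eq_bigr => i _.
rewrite normCK rmorph_sum mulr_suml mulr_sumr; apply: eq_bigr => k _.
rewrite mulr_sumr mulr_sumr; apply: eq_bigr => l _.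
by rewrite rmorphM /= conjCK; ring.
Qed.

Lemma spectral_parseval A P d x : spectral_decomposition A P d ->
  \sum_i `|\sum_k x k * (P i k)^*| ^+ 2 = \sum_k `|x k| ^+ 2.
Proof.
case=> _ PP _ _.
(* The Kronecker delta is inserted so that the orthonormality of the columns of [P] can replace
   it. *)
transitivity (\sum_k \sum_l x k * (x l)^* * (k == l)%:R); last first.
  apply: eq_bigr => k _; rewrite (bigD1 k) //= eqxx mulr1 big1 ?addr0 -?normCK //.
  by move=> l /negPf; rewrite eq_sym => ->; rewrite mulr0.
under [in RHS]eq_bigr => k _ do under eq_bigr => l _ do rewrite -PP mulr_sumr.
under [in RHS]eq_bigr => k _ do rewrite exchange_big /=.
rewrite [RHS]exchange_big /=; apply: eq_bigr => i _.
rewrite normCK rmorph_sum mulr_suml; apply: eq_bigr => k _.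
rewrite mulr_sumr; apply: eq_bigr => l _.
by rewrite rmorphM /= conjCK; ring.
Qed.

Lemma spectral_trace A P d : spectral_decomposition A P d -> \sum_i d i = \tr A.
Proof.
case=> PP _ AE _; apply: (fmorph_inj rc); rewrite !rmorph_sum /=.
under [in RHS]eq_bigr => k _ do rewrite AE.
rewrite exchange_big /=; apply: eq_bigr => i _.
rewrite -mulr_sumr; under eq_bigr => k _ do rewrite mulrC.
by rewrite PP eqxx mulr1.
Qed.

(** The eigenvalues sum to the trace, so adding them changes nothing; each summand [|d i| + d i] is
    twice the positive part of [d i]. *)
Lemma spectral_energy A P d : spectral_decomposition A P d -> \tr A = 0 ->
  \sum_(x <- eigenvalues A) `|x| = \sum_i (`|d i| + d i).
Proof.
move=> S trA; rewrite big_split /= (spectral_trace S) trA addr0.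
by case: S => _ _ _ /(perm_big _) ->; rewrite big_map big_enum.
Qed.


Lemma spectral_coord A P d (c : 'I_n -> R[i]) i : spectral_decomposition A P d ->
  \sum_k (\sum_j c j * P j k) * (P i k)^* = c i.
Proof.
case=> PP _ _ _; under eq_bigr => k _ do rewrite mulr_suml.
rewrite exchange_big /= (bigD1 i) //= [X in _ + X]big1 => [|j ji].
  under eq_bigr => k _ do rewrite -mulrA.
  by rewrite -mulr_sumr PP eqxx mulr1 addr0.
under eq_bigr => k _ do rewrite -mulrA.
by rewrite -mulr_sumr PP (negPf ji) mulr0.
Qed.

Lemma hform_comb A P d (c : 'I_n -> R[i]) : spectral_decomposition A P d ->
  hform A (fun k => \sum_j c j * P j k) = \sum_i rc (d i) * `|c i| ^+ 2.
Proof.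
move=> S; rewrite (hform_spectral _ S).
by apply: eq_bigr => i _; rewrite (spectral_coord _ _ S).
Qed.

(* Two eigenvectors with positive eigenvalues would span a plane meeting the
   hyperplane [\sum_k x k = 0] nontrivially. *)
Lemma at_most_one_pos A P d : spectral_decomposition A P d ->
  (forall x, \sum_k x k = 0 -> hform A x <= 0) ->
  forall i j, i != j -> 0 < d i -> d j <= 0.
Proof.
move=> S neg i j ij di; rewrite leNgt; apply/negP => dj.
pose s i := \sum_k P i k.
have sumc (c : 'I_n -> R[i]) :
    \sum_k \sum_m c m * P m k = \sum_m c m * s m.
  by rewrite exchange_big; apply: eq_bigr => m _; rewrite mulr_sumr.
have neg_comb (c : 'I_n -> R[i]) :
    \sum_m c m * s m = 0 -> \sum_m rc (d m) * `|c m| ^+ 2 <= 0.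
  by move=> c0; rewrite -(hform_comb c S); apply: neg; rewrite sumc.
(* If row [j] of [P] sums to zero, it alone violates [neg]. *)
have [sj0|sj0] := eqVneq (s j) 0.
  have := neg_comb (fun m => (m == j)%:R); rewrite (bigD1 j) //= sj0 mulr0 add0r.
  rewrite big1 => [/(_ erefl)|m /negPf ->]; last by rewrite mul0r.
  rewrite (bigD1 j) //= eqxx normr1 expr1n mulr1 big1 => [|m /negPf ->].
    by rewrite addr0 (lecR _ 0) leNgt dj.
  by rewrite normr0 expr0n mulr0.
(* This combination of rows [i] and [j] has coordinate sum [s j * s i - s i * s j = 0]; as [s j] is
   nonzero, its form is positive. *)
pose c m : R[i] := if m == i then s j else if m == j then - s i else 0.
have ci : c i = s j by rewrite /c eqxx.
have cj : c j = - s i by rewrite /c eqxx eq_sym (negPf ij).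
have c0 m : (m != i) && (m != j) -> c m = 0.
  by case/andP=> /negPf mi /negPf mj; rewrite /c mi mj.
have ji : j != i by rewrite eq_sym.
have := neg_comb c; rewrite (bigD1 i) //= (bigD1 j) //= big1 => [|m /c0 ->].
  rewrite ci cj addr0 mulNr mulrC subrr => /(_ erefl).
  rewrite (bigD1 i) //= (bigD1 j) //= big1 => [|m /c0 ->].
    rewrite addr0 ci cj normrN => /le_lt_trans.
    have ppos : 0 < rc (d i) * `|s j| ^+ 2 + rc (d j) * `|s i| ^+ 2.
      rewrite ltr_pwDl //; last by rewrite mulr_ge0 ?exprn_ge0 // real_complex_ge0 ltW.
      by rewrite mulr_gt0 ?exprn_gt0 ?normr_gt0 // (ltcR 0).
    by move=> /(_ _ ppos); rewrite ltxx.
  by rewrite normr0 expr0n mulr0.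
by rewrite mul0r.
Qed.

(** * Comparison of energies under entrywise domination *)

Lemma le_hform A B x : (forall k l, `|B k l| <= A k l) ->
  `|hform B x| <= hform A (fun k => `|x k|).
Proof.
move=> BA; apply: le_trans (ler_norm_sum _ _ _) _; apply: ler_sum => k _.
apply: le_trans (ler_norm_sum _ _ _) _; apply: ler_sum => l _.
rewrite !normrM norm_conjC [(`|x l|)^*]conj_Creal ?normr_real //.
rewrite !ler_wpM2r // normc_def /= expr0n addr0 sqrtr_sqr lecR.
exact: BA.
Qed.

Lemma energy_le A B : A^T = A -> B^T = B -> \tr A = 0 -> \tr B = 0 ->
  (forall k l, `|B k l| <= A k l) ->
  (forall x, \sum_k x k = 0 -> hform B x <= 0) ->
  \sum_(a <- eigenvalues B) `|a| <= \sum_(a <- eigenvalues A) `|a|.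
Proof.
move=> /sym_spectral[P [d SA]] /sym_spectral[Q [c SB]] trA trB BA neg.
rewrite (spectral_energy SA) // (spectral_energy SB) //.
have pge0 i : 0 <= `|d i| + d i by rewrite -lerBlDr sub0r -normrN ler_norm.
(* If [B] has no positive eigenvalue, its energy is zero. *)
case: (pickP (fun i => 0 < c i)) => [i ci|cle0]; last first.
  rewrite big1 ?sumr_ge0 // => i _.
  by rewrite ler0_norm ?addNr // leNgt cle0.
rewrite (bigD1 i) //= big1 ?addr0 => [|j ji]; last first.
  rewrite ler0_norm ?addNr //.
  by apply: (at_most_one_pos SB neg _ ci); rewrite eq_sym.
rewrite (gtr0_norm ci) -lecR rmorphD rmorph_sum /=.
(* The unit eigenvector for [c i], written as a combination of rows so that [hform_comb] applies. *)
pose x k := \sum_j (j == i)%:R * Q j k.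
have xE k : x k = Q i k.
  rewrite /x (bigD1 i) //= eqxx mul1r big1 ?addr0 //.
  by move=> j /negPf ->; rewrite mul0r.
have hx : hform B x = rc (c i).
  rewrite (hform_comb _ SB) (bigD1 i) //= eqxx normr1 expr1n mulr1.
  by rewrite big1 ?addr0 // => j /negPf ->; rewrite normr0 expr0n mulr0.
have nx : \sum_k `|x k| ^+ 2 = 1.
  have [QQ _ _ _] := SB; transitivity ((i == i)%:R : R[i]).
    by rewrite -QQ; apply: eq_bigr => k _; rewrite xE normCK.
  by rewrite eqxx.
have := le_hform x BA; rewrite hx ger0_norm; last by rewrite real_complex_ge0 ltW.
rewrite (hform_spectral _ SA).
(* In the eigenbasis of [A], the squared coordinates of the unit vector [|x|] are weights [w j] with
   sum 1. *)
have := spectral_parseval (fun k => `|x k|) SA.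
under [in RHS]eq_bigr => k _ do rewrite normr_id.
rewrite nx; pose w j := `|\sum_k `|x k| * (P j k)^*| ^+ 2.
rewrite -[\sum_(i < n) `|_| ^+ 2]/(\sum_j w j) => w1 le_c.
(* Termwise, [2 d w <= (|d| + d) w <= |d| + d] since [0 <= w <= 1]; a negative [d] gives 0 on the
   right. *)
apply: (@le_trans _ _ (\sum_k (rc (d k) * w k) *+ 2)).
  by rewrite sumrMnl mulr2n lerD.
apply: ler_sum => k _.
have wk0 j : 0 <= w j by rewrite exprn_ge0.
have wk1 : w k <= 1.
  by rewrite -w1 [leRHS](bigD1 k) //= lerDl sumr_ge0.
rewrite -mulrnAl -rmorphMn /=.
apply: (@le_trans _ _ (rc (`|d k| + d k) * w k)).
  by rewrite ler_wpM2r // lecR mulr2n lerD2r ler_norm.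
by rewrite ler_piMr // real_complex_ge0.
Qed.

(** Grouping the indices by fibres of [f] turns the form into a sum of squared moduli, one for each
    fibre. *)
Lemma hform_kernel_ge0 (T : finType) (f : 'I_n -> T) x :
  0 <= hform (\matrix_(k, l) (f k == f l)%:R) x.
Proof.
have -> : hform (\matrix_(k, l) (f k == f l)%:R) x =
    \sum_t `|\sum_(k | f k == t) x k| ^+ 2.
  under [RHS]eq_bigr => t _ do
    rewrite normCK rmorph_sum big_mkcond mulr_suml /=.
  rewrite exchange_big /=; apply: eq_bigr => k _.
  rewrite (bigD1 (f k)) //= eqxx [X in _ + X]big1 => [|t]; last first.
    by rewrite eq_sym => /negPf ->; rewrite mul0r.
  rewrite addr0 mulr_sumr [RHS]big_mkcond; apply: eq_bigr => l _ /=.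
  rewrite mxE [f l == _]eq_sym.
  by case: (f k == f l); rewrite ?rmorph1 ?rmorph0 ?mul1r ?mul0r.
by rewrite sumr_ge0 // => t _; rewrite exprn_ge0.
Qed.

(** The all-ones part contributes the squared modulus of [\sum_k x k], which vanishes; two
    nonpositive terms remain. *)
Lemma hform_le0 (T U : finType) (f : 'I_n -> T) (g : 'I_n -> U) (a b : R) B :
  0 <= a -> 0 <= b ->
  (forall k l, B k l = 1 - a * (f k == f l)%:R - b * (g k == g l)%:R) ->
  forall x, \sum_k x k = 0 -> hform B x <= 0.
Proof.
move=> a0 b0 BE x x0.
have -> : hform B x = `|\sum_k x k| ^+ 2
    - rc a * hform (\matrix_(k, l) (f k == f l)%:R) x
    - rc b * hform (\matrix_(k, l) (g k == g l)%:R) x.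
  rewrite normCK rmorph_sum mulr_suml !mulr_sumr -!sumrB.
  apply: eq_bigr => k _; rewrite !mulr_sumr -!sumrB.
  apply: eq_bigr => l _; rewrite !mxE BE !rmorphB !rmorphM rmorph1 /=.
  by ring.
rewrite x0 normr0 expr0n /= sub0r -opprD oppr_le0.
by rewrite addr_ge0 // mulr_ge0 ?hform_kernel_ge0 // real_complex_ge0.
Qed.

End Spectral.

(** * Distances one and two, and monotonicity of distance *)

Section DistanceFacts.
Variables (V : finType) (e : rel V).
Implicit Types x y w : V.
Local Open Scope nat_scope.

Lemma dist_gt0 x y : connect e x y -> x != y -> 0 < dist e x y.
Proof. by case/dist_walk => [[|z s] [_ /= <- <-]] //; rewrite eqxx. Qed.

Lemma dist_adj x y : x != y -> e x y -> dist e x y = 1.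
Proof.
move=> xy exy; apply/eqP; rewrite eqn_leq dist_gt0 ?connect1 // andbT.
by apply: (@dist_min _ _ x [:: y]); rewrite /= exy.
Qed.

Lemma dist_common_neighbour x y w :
  x != y -> ~~ e x y -> e x w -> e w y -> dist e x y = 2.
Proof.
move=> xy nexy exw ewy.
have cxy : connect e x y := connect_trans (connect1 exw) (connect1 ewy).
apply/eqP; rewrite eqn_leq (@dist_min _ _ x [:: w; y]) /= ?exw ?ewy //=.
case: (dist_walk cxy) => [[|z [|z' s]] [ps ls <-]] //=.
- by rewrite /= in ls; rewrite ls eqxx in xy.
- by move: ps nexy; rewrite /= in ls; rewrite /= ls andbT => ->.
Qed.

Lemma dist_subrel (e' : rel V) x y :
  subrel e' e -> connect e' x y -> dist e x y <= dist e' x y.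
Proof. by move=> ee /dist_walk[s [/(sub_path ee)/dist_min ps <- <-]]. Qed.

End DistanceFacts.

(** * The reciprocal distance matrix after deleting an edge *)

Section DeletedEdge.
Variables (R : realType) (p q r : nat).
Hypotheses (p_gt0 : (0 < p)%N) (q_gt0 : (0 < q)%N) (r_gt0 : (0 < r)%N).
Variables u v : tripartite_vertex p q r.
Hypothesis uv : complete_tripartite u v.

Let V := tripartite_vertex p q r.
Let e : rel V := @complete_tripartite p q r.
Let e' : rel V := delete_edge e u v.

Lemma part_neq_exists (a b : 'I_3) :
  exists w : V, (tripartite_part w != a) && (tripartite_part w != b).
Proof.
have : (0 < #|~: [set a; b]|)%N.
  by rewrite cardsCs setCK card_ord cards2; case: eqP.
case/card_gt0P => c; rewrite !inE negb_or => ab.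
suff [w wc] : exists w : V, tripartite_part w = c by exists w; rewrite wc.
case: c {ab} => [[|[|[|//]]] lt3];
  [exists (inl (inl (Ordinal p_gt0))) | exists (inl (inr (Ordinal q_gt0)))
  | exists (inr (Ordinal r_gt0))]; by apply: val_inj; rewrite /= inordK.
Qed.

(** Two distinct vertices have the same image exactly when they are the ends of the deleted edge,
    which makes the deletion a kernel condition. *)
Definition merge_edge (x : V) : V := if x == v then u else x.

Lemma set2_eq_merge_edge (x y : V) : x != y ->
  ([set x; y] == [set u; v]) = (merge_edge x == merge_edge y).
Proof.
have nuv : u != v by apply: contraTneq uv => ->; rewrite /complete_tripartite eqxx.
move=> xy; rewrite /merge_edge; apply/eqP/idP => [E|].
  have xuv : x \in [set u; v] by rewrite -E !inE eqxx.
  have yuv : y \in [set u; v] by rewrite -E !inE eqxx orbT.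
  move: xuv yuv xy {E}; rewrite !inE.
  by move=> /orP[]/eqP-> /orP[]/eqP->; rewrite ?eqxx ?(negPf nuv) ?eqxx.
have [xv|_] := eqVneq x v; have [yv|_] := eqVneq y v => /eqP E.
- by rewrite xv yv eqxx in xy.
- by rewrite xv -E setUC.
- by rewrite E yv.
- by rewrite E eqxx in xy.
Qed.

Let e_sym : symmetric e. Proof. exact: complete_tripartite_sym. Qed.

Let e'_sym : symmetric e'. Proof. exact: delete_edge_sym. Qed.

Lemma delete_edge_adj (x y : V) : x \notin [set u; v] -> e x y -> e' x y.
Proof.
move=> xuv exy; rewrite /e' /delete_edge exy; apply: contraNneq xuv => <-.
by rewrite !inE eqxx.
Qed.

(** Take [w] in the third part, away from [u] and [v]. It is adjacent to every vertex outside its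
    part, and [u] to every vertex inside it. So [u] serves two vertices inside, [w] two outside, and
    a mixed pair is adjacent. *)
Lemma delete_edge_common_neighbour (x y : V) :
  ~~ e' x y -> exists w, e' x w && e' w y.
Proof.
have out (z : V) : tripartite_part z != tripartite_part u ->
    tripartite_part z != tripartite_part v -> z \notin [set u; v].
  by rewrite !inE negb_or => zu zv; apply/andP; split;
    [apply: contraNneq zu => -> | apply: contraNneq zv => ->].
have [w /andP[wu wv]] := part_neq_exists (tripartite_part u) (tripartite_part v).
have adjw z : tripartite_part z != tripartite_part w -> e' z w && e' w z.
  by move=> zw; rewrite e'_sym andbb delete_edge_adj ?out // e_sym.
have adju z : tripartite_part z = tripartite_part w -> e' z u && e' u z.
  move=> zw; rewrite [e' u z]e'_sym andbb.
  by apply: delete_edge_adj; [apply: out | rewrite /e /complete_tripartite]; rewrite zw.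
have [xw|xw] := eqVneq (tripartite_part x) (tripartite_part w);
  have [yw|yw] := eqVneq (tripartite_part y) (tripartite_part w).
- by exists u; case/andP: (adju x xw) => -> _; case/andP: (adju y yw).
- case/negP; apply: delete_edge_adj; first by apply: out; rewrite xw.
  by rewrite /e /complete_tripartite xw eq_sym.
- case/negP; rewrite e'_sym; apply: delete_edge_adj; first by apply: out; rewrite yw.
  by rewrite /e /complete_tripartite yw eq_sym.
- by exists w; case/andP: (adjw x xw) => -> _; case/andP: (adjw y yw).
Qed.

(** All distances are at most 2. Both kernels are 1 on the diagonal, neither on adjacent pairs,
    exactly one on the other pairs, giving 0, 1 and 1/2. *)
Lemma RD_delete_edgeE k l :
  RD R e' k l = 1
    - 2^-1 * (tripartite_part (enum_val k) == tripartite_part (enum_val l))%:R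
    - 2^-1 * (merge_edge (enum_val k) == merge_edge (enum_val l))%:R.
Proof.
rewrite mxE; have [->|kl] := eqVneq k l.
  by rewrite !eqxx /= !mulr1 -addrA -opprD -div1r -splitr subrr.
have xy : enum_val k != enum_val l by rewrite (inj_eq enum_val_inj).
move: (enum_val k) (enum_val l) xy => x y xy.
have e'E : e' x y = (tripartite_part x != tripartite_part y) &&
    (merge_edge x != merge_edge y).
  by rewrite -(set2_eq_merge_edge xy).
have [/[dup] exy|nexy] := boolP (e' x y).
  rewrite e'E => /andP[/negPf -> /negPf ->].
  by rewrite dist_adj // invr1 !mulr0 !subr0.
have [w /andP[xw wy]] := delete_edge_common_neighbour nexy.
rewrite (dist_common_neighbour xy nexy xw wy).
(* The two kernels cannot both be 1 here, because [u] and [v] lie in different parts. *)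
have : (tripartite_part x == tripartite_part y) (+) (merge_edge x == merge_edge y).
  move: nexy; rewrite e'E negb_and !negbK.
  case: eqP => [E _|_ /= ->] //; rewrite -(set2_eq_merge_edge xy) addTb.
  apply: contraTneq uv => /setP E2.
  have := E2 u; have := E2 v; rewrite !inE !eqxx orbT /=.
  by rewrite /complete_tripartite => /orP[]/eqP-> /orP[]/eqP->; rewrite ?E eqxx.
by case: eqP => _; case: eqP => // _ _; rewrite mulr0 mulr1 ?subr0; field.
Qed.

(** Deleting an edge can only lengthen distances; connectedness makes them positive off the
    diagonal, so inversion reverses the inequality. *)
Lemma RD_delete_edge_le k l : `|RD R e' k l| <= RD R e k l.
Proof.
rewrite !mxE; have [_|kl] := eqVneq k l; first by rewrite normr0.
have c := delete_edge_connected p_gt0 q_gt0 r_gt0 uv (enum_val k) (enum_val l).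
have sub : subrel e' e by move=> x y /andP[].
have c' : connect e (enum_val k) (enum_val l).
  by apply: (connect_sub _ c) => x y /sub/connect1.
have xy : enum_val k != enum_val l by rewrite (inj_eq enum_val_inj).
rewrite ger0_norm ?invr_ge0 ?ler0n // lef_pV2 ?posrE ?ltr0n ?dist_gt0 //.
by rewrite ler_nat dist_subrel.
Qed.

End DeletedEdge.

Theorem theorem11 (R : realType) (p q r : nat)
  (hp : (1 <= p)%N) (hq : (1 <= q)%N) (hr : (1 <= r)%N)
  (u v : tripartite_vertex p q r) (huv : complete_tripartite u v) :
  RD_energy R (delete_edge (@complete_tripartite p q r) u v)
    <= RD_energy R (@complete_tripartite p q r).
Proof.
have es := @complete_tripartite_sym p q r.
have tr0 (e : rel (tripartite_vertex p q r)) : \tr (RD R e) = 0.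
  by rewrite /mxtrace big1 // => i _; rewrite mxE eqxx.
apply: energy_le; rewrite ?tr0 //.
- exact: RD_sym.
- by apply: RD_sym; apply: delete_edge_sym.
- exact: RD_delete_edge_le.
- by apply: hform_le0 (RD_delete_edgeE R hp hq hr huv); rewrite invr_ge0.
Qed.
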